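(* Let $n,k\in\mathbb{N}$ and let $\mathcal{M}_k$ be a mutex network consisting of $k$ mutexes over the set of Boolean variables $X=\{x_1,x_2,\dots,x_n\}$. The algorithm Exact-Cliques (defined in the context), run on input $\mathcal{M}_k$, has worst-case time complexity $\mathcal{O}(k\cdot 2^{3n})$ and worst-case space complexity $\mathcal{O}(2^{2n})$.
   Context: A mutex network of size $k$ over Boolean variables $X=\{x_1,\dots,x_n\}$ is a set of binary clauses $\mathcal{M}_k=\{(\neg x_{u_i}\vee\neg x_{v_i}) \mid u_i,v_i\in\{1,\dots,n\},\ i=1,\dots,k\}$. Each such clause is called a mutex; it can be viewed as the edge $\{u_i,v_i\}$ of an undirected graph on $\{1,\dots,n\}$. The algorithm maintains a collection $\mathcal{C}$ of subsets of $\{1,\dots,n\}$, called clusters (being a set of subsets, $\mathcal{C}$ contains each cluster at most once), and for pairs of subsets $K,K'\subseteq\{1,\dots,n\}$ an integer $\mathcal{E}(K,K')$ (the value of the meta-edge between $K$ and $K'$). Algorithm Exact-Cliques($\mathcal{M}_k$): (1) Let $\mathcal{E}(K,K')=0$ for all $K,K'\subseteq\{1,\dots,n\}$. (2) Initialize $\mathcal{C}$ to consist of the singletons $\{1\},\{2\},\dots,\{n\}$. (3) For each mutex $(\neg x_{u_i}\vee\neg x_{v_i})\in\mathcal{M}_k$: for each $K_u\in\mathcal{C}$ with $u_i\in K_u$, and for each $K_v\in\mathcal{C}$ with $v_i\in K_v$, call Increment-Cluster-Link($K_u,K_v$). (4) Return $\mathcal{C}$. Procedure Increment-Cluster-Link($K_u,K_v$):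 (a) Set $\mathcal{E}(K_u,K_v)\gets\mathcal{E}(K_u,K_v)+1$. (b) If $\mathcal{E}(K_u,K_v)=|K_u\setminus(K_u\cap K_v)|\cdot|K_v\setminus(K_u\cap K_v)|$, then: for each $K\in\mathcal{C}$ such that $\mathcal{E}(K,K_u)>0$ or $\mathcal{E}(K,K_v)>0$, set $\mathcal{E}(K,K_u\cup K_v)\gets\mathcal{E}(K,K_u)+\mathcal{E}(K,K_v)-\mathcal{E}(K,K_u\cap K_v)$; afterwards set $\mathcal{C}\gets\mathcal{C}\cup\{K_u\cup K_v\}$. Complexity convention: each elementary operation on clusters (membership test, cardinality, union, intersection, difference, insertion into $\mathcal{C}$) and each read, write or arithmetic operation on an entry of $\mathcal{E}$ is counted as one step, and each stored cluster and each stored entry of $\mathcal{E}$ is counted as one unit of space. *)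

(* Defs.v *)
From mathcomp Require Import all_boot all_order all_algebra.

Set Implicit Arguments.
Unset Strict Implicit.
Unset Printing Implicit Defensive.

(* The variables x_1, ..., x_n are indexed by 'I_n. *)

(* The pair (u, v) stands for the clause (~ x_u \/ ~ x_v).  A mutex network
   of size k is a set M : {set mutex n} with #|M| = k. *)
Definition mutex (n : nat) : finType := ('I_n * 'I_n)%type.

Definition cluster (n : nat) : finType := {set 'I_n}.

(* [entry (K, K') = None] means that no value is stored for E(K, K').
   [time] counts the elementary steps performed so far, [peak] is the largest
   number of stored clusters and stored entries reached so far. *)
Record state (n : nat) := State {
  clusters : {set cluster n};
  entry : {ffun cluster n * cluster n -> option int};
  time : nat;
  peak : nat
}.

Definition usage n (C : {set cluster n})
    (E : {ffun cluster n * cluster n -> option int}) : nat :=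
  #|C| + #|[set p | E p != None]|.

Definition start n : state n := State set0 [ffun => None] 0 0.

Definition prog (n : nat) (A : Type) := state n -> A * state n.

Definition ret n A (a : A) : prog n A := fun s => (a, s).

Definition bind n A B (m : prog n A) (f : A -> prog n B) : prog n B :=
  fun s => let: (a, s') := m s in f a s'.

Notation "'let*' x ':=' m 'in' p" := (bind m (fun x => p))
  (at level 200, x name, m at level 100, p at level 200, right associativity).
Notation "m ;; p" := (bind m (fun _ => p))
  (at level 199, right associativity).

(* A single cluster operation, arithmetic operation or comparison with
   result a. *)
Definition step n A (a : A) : prog n A :=
  fun s => (a, State (clusters s) (entry s) (time s).+1 (peak s)).

Definition readE n (K K' : cluster n) : prog n int :=
  fun s => (odflt 0%R (entry s (K, K')),
            State (clusters s) (entry s) (time s).+1 (peak s)).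

(* With [undirected], E(K, K') and E(K', K) are one meta-edge, which is kept at
   both positions (and counted twice in [usage]); otherwise they are two
   independent values. *)
Definition writeE n (undirected : bool) (K K' : cluster n) (z : int)
    : prog n unit :=
  fun s =>
    let E := [ffun p => if (p == (K, K')) || undirected && (p == (K', K))
                        then Some z else entry s p] in
    (tt, State (clusters s) E (time s).+1 (maxn (peak s) (usage (clusters s) E))).

Definition insertC n (K : cluster n) : prog n unit :=
  fun s =>
    let C := K |: clusters s in
    (tt, State C (entry s) (time s).+1 (maxn (peak s) (usage C (entry s)))).

Fixpoint foreach n (T : Type) (r : seq T) (body : T -> prog n unit)
    : prog n unit :=
  if r is x :: r' then body x ;; foreach r' body else ret tt.

(* A policy fixes what the pseudocode leaves open: whether meta-edges are
   directed (see [writeE]), and the iteration orders of the loops over the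
   network and over the collection of clusters, which may grow while it is
   being traversed.  [cluster_order s] is the order of visits of a loop over the
   clusters that is entered in state s.  It contains every cluster present in s,
   and it may contain further sets, each of which is visited if it has become a
   cluster by the time its turn comes (see [foreach_cluster]).  Hence both loops
   over a copy of the collection made on entry and loops that also visit
   clusters inserted during the traversal are covered; no cluster is visited
   twice by the same loop. *)
Record policy (n : nat) := Policy {
  undirected : bool;
  mutex_order : {set mutex n} -> seq (mutex n);
  cluster_order : state n -> seq (cluster n);
  mutex_orderP : forall M, perm_eq (mutex_order M) (enum M);
  cluster_order_uniq : forall s, uniq (cluster_order s);
  cluster_order_sub : forall s, {subset clusters s <= cluster_order s}
}.

Definition foreach_cluster n (pol : policy n)
    (body : cluster n -> prog n unit) : prog n unit :=
  fun s0 => foreach (cluster_order pol s0)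
    (fun K s => if K \in clusters s then body K s else (tt, s)) s0.

Definition update_link n (pol : policy n) (Ku Kv K : cluster n) : prog n unit :=
  let* eu := readE K Ku in
  let* bu := step (0 < eu)%R in
  let* ev := readE K Kv in
  let* bv := step (0 < ev)%R in
  if bu || bv then
    let* U := step (Ku :|: Kv) in
    let* fu := readE K Ku in
    let* fv := readE K Kv in
    let* sum := step (fu + fv)%R in
    let* I := step (Ku :&: Kv) in
    let* fi := readE K I in
    let* z := step (sum - fi)%R in
    writeE (undirected pol) K U z
  else ret tt.

Definition increment_cluster_link n (pol : policy n) (Ku Kv : cluster n)
    : prog n unit :=
  let* e := readE Ku Kv in
  let* e1 := step (e + 1)%R in
  writeE (undirected pol) Ku Kv e1 ;;
  let* f := readE Ku Kv in
  let* I := step (Ku :&: Kv) in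
  let* Du := step (Ku :\: I) in
  let* du := step #|Du| in
  let* J := step (Ku :&: Kv) in
  let* Dv := step (Kv :\: J) in
  let* dv := step #|Dv| in
  let* d := step (du * dv) in
  let* full := step (f == Posz d) in
  if full then
    foreach_cluster pol (update_link pol Ku Kv) ;;
    let* U := step (Ku :|: Kv) in
    insertC U
  else ret tt.

Definition process_mutex n (pol : policy n) (m : mutex n) : prog n unit :=
  foreach_cluster pol (fun Ku =>
    let* inu := step (m.1 \in Ku) in
    if inu then
      foreach_cluster pol (fun Kv =>
        let* inv := step (m.2 \in Kv) in
        if inv then increment_cluster_link pol Ku Kv else ret tt)
    else ret tt).

Definition exact_cliques n (pol : policy n) (M : {set mutex n})
    : prog n {set cluster n} :=
  foreach (enum {: cluster n * cluster n})
    (fun p => writeE (undirected pol) p.1 p.2 0%R) ;;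
  foreach (enum 'I_n) (fun i => insertC [set i]) ;;
  foreach (mutex_order pol M) (process_mutex pol) ;;
  fun s => (clusters s, s).

Definition run_time n (pol : policy n) (M : {set mutex n}) : nat :=
  time (exact_cliques pol M (start n)).2.

Definition run_space n (pol : policy n) (M : {set mutex n}) : nat :=
  peak (exact_cliques pol M (start n)).2.

(* Main.v *)
Require Import Defs.
From mathcomp Require Import all_boot all_order all_algebra.
From mathcomp Require Import zify.

(** There are N = 2 ^ n subsets of the variables, so a loop over the clusters
    makes at most N iterations. A mutex triggers two nested loops over the
    clusters, each inner iteration of which runs at most one further such loop
    with a constant-time body, which costs O(N ^ 3). At any moment at most N
    clusters and N ^ 2 entries are stored. *)

Set Implicit Arguments.
Unset Strict Implicit.
Unset Printing Implicit Defensive.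

Definition space_bound (n : nat) : nat := 2 ^ n + 2 ^ n * 2 ^ n.

(** Quantifying over all start states makes the two parts compose under [bind]: times add up, and
    the space bound is an invariant passed along the run. *)
Definition runs_within n A (t : nat) (m : prog n A) : Prop :=
  forall s, time (m s).2 <= time s + t /\
    (peak s <= space_bound n -> peak (m s).2 <= space_bound n).

Lemma card_cluster n : #|{: cluster n}| = 2 ^ n.
Proof. by rewrite -cardsT -powersetT card_powerset cardsT card_ord. Qed.

Lemma usage_le n (C : {set cluster n}) E : usage C E <= space_bound n.
Proof.
apply: leq_add; first by rewrite -card_cluster max_card.
by rewrite -card_cluster -card_prod max_card.
Qed.

(** A visiting order is duplicate-free, so even a loop over a growing collection visits each of the
    [2 ^ n] subsets at most once. *)
Lemma size_cluster_order n (pol : policy n) s :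
  size (cluster_order pol s) <= 2 ^ n.
Proof.
by rewrite -card_cluster -(card_uniqP (cluster_order_uniq pol s)) max_card.
Qed.

Lemma runs_within_ret n A t (a : A) : runs_within t (@ret n A a).
Proof. by move=> s; split; rewrite //= leq_addr. Qed.

Lemma runs_within_step n A (a : A) : runs_within 1 (@step n A a).
Proof. by move=> s; rewrite /= addn1. Qed.

Lemma runs_within_readE n (K K' : cluster n) : runs_within 1 (readE K K').
Proof. by move=> s; rewrite /= addn1. Qed.

Lemma runs_within_writeE n b (K K' : cluster n) z :
  runs_within 1 (writeE b K K' z).
Proof. by move=> s; rewrite /= addn1 geq_max usage_le andbT. Qed.

Lemma runs_within_insertC n (K : cluster n) : runs_within 1 (insertC K).
Proof. by move=> s; rewrite /= addn1 geq_max usage_le andbT. Qed.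

Lemma runs_within_bind n A B t u (m : prog n A) (f : A -> prog n B) :
  runs_within t m -> (forall a, runs_within u (f a)) ->
  runs_within (t + u) (bind m f).
Proof.
move=> mt fu s; rewrite /bind; case: (mt s); case: (m s) => a s' /= ts' ps'.
have [tf pf] := fu a s'; split; last by move/ps'.
by rewrite addnA (leq_trans tf) // leq_add2r.
Qed.

(** The successor form lets each elementary operation peel one unit off a numeral bound. *)
Lemma runs_within_bind1 n A B t (m : prog n A) (f : A -> prog n B) :
  runs_within 1 m -> (forall a, runs_within t (f a)) ->
  runs_within t.+1 (bind m f).
Proof. exact: runs_within_bind. Qed.

Lemma runs_within_if n A t (b : bool) (m m' : prog n A) :
  runs_within t m -> runs_within t m' -> runs_within t (if b then m else m').
Proof. by case: b. Qed.

Lemma runs_within_foreach n T t (r : seq T) (body : T -> prog n unit) :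
  (forall x, runs_within t (body x)) ->
  runs_within (size r * t) (foreach r body).
Proof.
move=> bodyt; elim: r => [|x r IHr]; first exact: runs_within_ret.
by rewrite /= mulSn; apply: runs_within_bind.
Qed.

Lemma runs_within_foreach_cluster n t (pol : policy n) body :
  (forall K, runs_within t (body K)) ->
  runs_within (2 ^ n * t) (foreach_cluster pol body).
Proof.
move=> bodyt s; rewrite /foreach_cluster.
set body' := (X in foreach _ X).
have body't K : runs_within t (body' K).
  move=> s'; rewrite /body'; case: ifP => _; first exact: bodyt.
  exact: runs_within_ret.
have [tm pk] := runs_within_foreach (cluster_order pol s) body't s.
split=> //; rewrite (leq_trans tm) // leq_add2l leq_mul2r.
by rewrite size_cluster_order orbT.
Qed.

(* Dispatching on the head symbol keeps unification from unfolding programs. *)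
Ltac runs_within_steps :=
  repeat lazymatch goal with
  | |- runs_within _ (step _) => apply: runs_within_step
  | |- runs_within _ (readE _ _) => apply: runs_within_readE
  | |- runs_within _ (writeE _ _ _ _) => apply: runs_within_writeE
  | |- runs_within _ (insertC _) => apply: runs_within_insertC
  | |- runs_within _ (ret _) => apply: runs_within_ret
  | |- runs_within _ (if _ then _ else _) => apply: runs_within_if
  | |- runs_within _ (bind (foreach_cluster _ _) _) => fail
  | |- runs_within _ (bind _ _) => apply: runs_within_bind1 => [|?]
  end.

(** Two reads and two tests come first, then at most eight operations in the branch. *)
Lemma runs_within_update_link n (pol : policy n) Ku Kv K :
  runs_within 12 (update_link pol Ku Kv K).
Proof. by rewrite /update_link; runs_within_steps. Qed.

(** Twelve operations lead up to the test of [full]; the final 2 pays for the union and its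
    insertion. *)
Lemma runs_within_increment_cluster_link n (pol : policy n) Ku Kv :
  runs_within (12 + (2 ^ n * 12 + 2)) (increment_cluster_link pol Ku Kv).
Proof.
rewrite /increment_cluster_link !addSn add0n; runs_within_steps.
(* The tactic stops at the loop over the clusters, whose cost is not 1. *)
apply: runs_within_bind => [|_]; last by runs_within_steps.
by apply: runs_within_foreach_cluster => K; apply: runs_within_update_link.
Qed.

Lemma runs_within_process_mutex n (pol : policy n) m :
  runs_within (2 ^ n * (2 ^ n * (12 + (2 ^ n * 12 + 2)).+1).+1)
    (process_mutex pol m).
Proof.
apply: runs_within_foreach_cluster => Ku; runs_within_steps.
apply: runs_within_foreach_cluster => Kv; runs_within_steps.
exact: runs_within_increment_cluster_link.
Qed.

Lemma runs_within_exact_cliques n (pol : policy n) (M : {set mutex n}) :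
  runs_within (2 ^ n * 2 ^ n + (n +
      (#|M| * (2 ^ n * (2 ^ n * (12 + (2 ^ n * 12 + 2)).+1).+1) + 0)))
    (exact_cliques pol M).
Proof.
apply: runs_within_bind => [|_].
  (* The bound is recast as the length of the loop times a body cost of 1. *)
  rewrite -card_cluster -card_prod cardE -[size _]muln1.
  by apply: runs_within_foreach => p; apply: runs_within_writeE.
apply: runs_within_bind => [|_].
  rewrite -[X in runs_within X](size_enum_ord n) -[size _]muln1.
  by apply: runs_within_foreach => i; apply: runs_within_insertC.
apply: runs_within_bind => [|_]; last by move=> s; rewrite addn0.
rewrite cardE -(perm_size (mutex_orderP pol M)).
by apply: runs_within_foreach => m; apply: runs_within_process_mutex.
Qed.

Theorem proposition1 :
  (exists c : nat, forall (n k : nat) (M : {set mutex n}) (pol : policy n),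
      0 < k -> #|M| = k -> run_time pol M <= c * (k * 2 ^ (3 * n)))
  /\
  (exists c : nat, forall (n k : nat) (M : {set mutex n}) (pol : policy n),
      #|M| = k -> run_space pol M <= c * 2 ^ (2 * n)).
Proof.
(* With N = [2 ^ n], 30 is 28 for the mutex loop plus 1 each for the N ^ 2 initial writes and the n
   singleton insertions; 2 comes from N + N ^ 2 <= 2 N ^ 2. *)
split; [exists 30 | exists 2] => n k M pol.
- move=> k_gt0 Mk; rewrite /run_time.
  have [+ _] := runs_within_exact_cliques pol M (start n).
  rewrite Mk add0n => /leq_trans; apply.
  have := ltn_expl n (ltnSn 1); rewrite (mulnC 3) expnM.
  move: (2 ^ n) => N n_ltN; have N_gt0 : 0 < N by apply: leq_trans n_ltN.
  have N2_le : N * N <= N ^ 3 by rewrite mulnn leq_pexp2l.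
  have N_le : N <= N ^ 3 by rewrite -[X in X <= _]expn1 leq_pexp2l.
  (* Here [0 < k] lets the initialization cost be absorbed into k N ^ 3. *)
  have N3_le : N ^ 3 <= k * N ^ 3 by rewrite leq_pmull.
  (* The left side expands to 12 N ^ 3 + 15 N ^ 2 + N, and 12 + 15 + 1 = 28. *)
  have body_le : N * (N * (12 + (N * 12 + 2)).+1).+1 <= 28 * N ^ 3.
    by move: N2_le N_le; rewrite !expnS expn0; lia.
  have := leq_mul (leqnn k) body_le; rewrite mulnCA.
  by lia.
(* The invariant holds initially because the peak of [start] is 0. *)
- move=> _; have [_ /(_ (leq0n _))] := runs_within_exact_cliques pol M (start n).
  move=> /leq_trans; apply; rewrite /space_bound (mulnC 2 n) expnM.
  have N_gt0 : 0 < 2 ^ n by rewrite expn_gt0.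
  by rewrite mulnn mul2n -addnn leq_add2r -mulnn leq_pmulr.
Qed.
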